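(* Let $T$ be a tree on $n\geq 6$ vertices, and let $g_0\geq 2$ be the smallest positive integer such that $2^{g_0-1}+g_0\geq n-3$. Then $$d_T(S_c,\mathfrak{C})\leq\begin{cases} 1, & \text{if } n=7,\\ n-g_0-3, & \text{if } n\neq 7,\end{cases}$$ and in both cases equality holds if $T$ is isomorphic to the path-star tree $P_{n-g_0,g_0}$.
   Context: For a tree $T$ and $u,v\in V(T)$, $d_T(u,v)$ is the number of edges of the $u$-$v$ path; for $X,Y\subseteq V(T)$, $d(X,Y)=\min\{d_T(x,y): x\in X, y\in Y\}$. For $v\in V(T)$, $f_T(v)$ is the number of subtrees (connected subgraphs) of $T$ containing $v$, and the subtree core $S_c(T)$ is the set of vertices maximizing $f_T(v)$. For $u,v\in V(T)$, $f_T(v,u)$ is the number of subtrees of $T$ containing both $v$ and $u$. The eccentric subtree number of $v$ is $\epsilon_T(v)=\min\{f_T(v,u):u\in V(T)\}$, and the core center $\mathfrak{C}(T)$ is the set of vertices maximizing $\epsilon_T$. Write $d_T(S_c,\mathfrak{C})=d(S_c(T),\mathfrak{C}(T))$. For integers $1\leq g\leq n-2$, the path-star tree $P_{n-g,g}$ is the tree on $n$ vertices obtained from the path $12\cdots (n-g)$ by attaching $g$ pendant vertices to the vertex $n-g$. *)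

(* Defs.v *)
From mathcomp Require Import all_boot.

Set Implicit Arguments.
Unset Strict Implicit.
Unset Printing Implicit Defensive.

Section Graph.

Variables (T : finType) (e : rel T).

Definition simple_graph : Prop := symmetric e /\ irreflexive e.

Definition graph_connected : Prop := forall x y : T, connect e x y.

(* [:: x; y] is an e-cycle in the sense of path.v whenever e x y and e y x,
   hence the lower bound on the length. *)
Definition acyclic : Prop := forall c : seq T, 2 < size c -> ~ ucycle e c.

Definition is_tree : Prop :=
  [/\ simple_graph, graph_connected, acyclic & 0 < #|T|].

Definition edges : {set {set T}} :=
  [set [set p.1; p.2] | p : T * T & e p.1 p.2].

(* A subgraph is a pair H of a vertex set H.1 and an edge set H.2; it need not
   be induced. *)
Definition is_subgraph (H : {set T} * {set {set T}}) : bool :=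
  (H.2 \subset edges) && [forall E in H.2, E \subset H.1].

Definition sub_adj (H : {set T} * {set {set T}}) : rel T :=
  fun x y => [set x; y] \in H.2.

(* The subtrees of a tree are its nonempty connected subgraphs. *)
Definition is_subtree (H : {set T} * {set {set T}}) : bool :=
  [&& is_subgraph H, H.1 != set0
    & [forall x in H.1, forall y in H.1, connect (sub_adj H) x y]].

Definition subtree_count (v : T) : nat :=
  #|[set H : {set T} * {set {set T}} | is_subtree H && (v \in H.1)]|.

Definition subtree_count2 (v u : T) : nat :=
  #|[set H : {set T} * {set {set T}} |
      [&& is_subtree H, v \in H.1 & u \in H.1]]|.

Definition subtree_core : {set T} :=
  [set v | [forall u, subtree_count u <= subtree_count v]].

(* The default value of the iterated minimum is one of its terms. *)
Definition ecc_subtree_number (v : T) : nat :=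
  \big[minn/subtree_count2 v v]_(u : T) subtree_count2 v u.

Definition core_center : {set T} :=
  [set v | [forall u, ecc_subtree_number u <= ecc_subtree_number v]].

(* p lists the vertices after u of a path (without repeated vertices) from u
   to v, so that size p is its number of edges. *)
Definition is_path (u v : T) (p : seq T) : bool :=
  [&& path e u p, last u p == v & uniq (u :: p)].

(* In a tree the u-v path is unique, so the first k found is its number of
   edges; k < #|T| since the path has k.+1 distinct vertices. *)
Definition dist (u v : T) : nat :=
  find (fun k => [exists p : k.-tuple T, is_path u v p]) (iota 0 #|T|).

(* The default #|T| exceeds every distance in a connected graph, so for
   nonempty X and Y this is the minimum of dist x y. *)
Definition set_dist (X Y : {set T}) : nat :=
  \big[minn/#|T|]_(x in X) \big[minn/#|T|]_(y in Y) dist x y.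

End Graph.

Definition isomorphic (T U : finType) (e : rel T) (e' : rel U) : Prop :=
  exists2 f : T -> U, bijective f & forall x y, e' (f x) (f y) = e x y.

(* P_{n-g,g} for 1 <= g <= n-2, with vertices numbered from 0: the path is
   0, ..., n-g-1 and the pendant vertices n-g, ..., n-1 are attached to
   n-g-1. *)
Definition path_star_arc (n g i j : nat) : bool :=
  ((j < n - g) && (j == i.+1)) || ((n - g <= j) && (i == (n - g).-1)).

Definition path_star (n g : nat) : rel 'I_n :=
  fun i j => path_star_arc n g i j || path_star_arc n g j i.

(* Main.v *)
Require Import Defs.
From mathcomp Require Import all_boot zify.

Set Implicit Arguments.
Unset Strict Implicit.
Unset Printing Implicit Defensive.

(** Write [f(v,u)] for the number of subtrees through [v] and [u].  A subtree is
determined by its vertex set, so [f(v,u)] counts connected vertex sets.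

Upper bound.  Take a core center vertex [c] and a core vertex [s] at minimal
distance [k > 0], and let [c'] be the neighbour of [c] towards [s].  As [c'] is
not in the core center, some [u] satisfies [f(c',u) < f(c,x)] for all [x]; in
particular [u] lies on the side of [c] away from [c'].  Let [d] be the number of
vertices of the path from [c] to [u], and let [x] be an end vertex of the tree
beyond [s], seen from [u]; [x] differs from [s], since a leaf has at most as many
subtrees as its neighbour.  With [K = f(s,u)]:
- [f(x,c) <= d * f(x,u)], because a connected set [I] through [c] is recovered
  from its union with the path from [c] to [u] and from the number of vertices
  that [I] has on that path ([nconn_leq_extend]);
- [2 * f(x,u) <= K], by deleting [x] ([nconn_delete_leaf]);
- [f(c',u) >= K + (k - 1)], because the paths from [u] that stop between [c'] and
  [s], short of [s], miss [s] ([nconn_add_prefixes]);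
- [K <= 2 ^ (n - d - k)] ([nconn_leq_exp]).
Hence [2 * (k - 1) < (d - 2) * K <= 2 ^ h] for [h = n - k - 3], so that
[k <= 2 ^ (h - 1)].  This says that [h] satisfies the inequality defining [g0];
so [g0 <= h], which is the bound.  For [n = 7] it remains to exclude
[k = 2], which contradicts the choice of [s]: moving from [s] one step towards
[c] does not decrease the number of subtrees, since at least four vertices lie on
that side ([nconn_leq_of_small_side]).

Equality.  Number the spine of the path-star tree [0, ..., m - 1], with
[m = n - g0] and the [g0] pendant vertices at the hub [m - 1].  Comparing
neighbours shows that the core is the hub, or, if [n = 7], lies in the hub and its
predecessor ([core_path_star]).  The eccentric subtree number of vertex [2] is
[f(2,0) = 2 ^ g0 + (m - 3)]; a vertex further from [0] has fewer subtrees through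
[0], and the vertices [0] and [1] have at most [2 ^ g0] subtrees through a pendant
vertex ([center_path_star]).  So the core center is vertex [2]. *)

(** * Minima and families of sets *)

Lemma bigmin_geq (I : finType) (P : pred I) F d m :
  m <= d -> (forall i, P i -> m <= F i) -> m <= \big[minn/d]_(i | P i) F i.
Proof. by move=> md mF; elim/big_ind: _ => // a b; rewrite leq_min => -> ->. Qed.

Lemma bigmin_leq (I : finType) (P : pred I) F d i :
  P i -> \big[minn/d]_(j | P j) F j <= F i.
Proof.
move=> Pi; have := mem_index_enum i; elim: (index_enum I) => // a r IH.
rewrite inE big_cons => /predU1P[<-|/IH h]; first by rewrite Pi geq_minl.
by case: ifP => // _; rewrite geq_min h orbT.
Qed.

Lemma card_sets_between (T : finType) (S B : {set T}) (F : {set {set T}}) :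
  (forall V, V \in F -> S \subset V /\ V \subset S :|: B) -> #|F| <= 2 ^ #|B|.
Proof.
move=> h; rewrite -card_powerset.
have inj : {in F &, injective (fun V => V :&: B)}.
  move=> V W /h[SV VB] /h[SW WB] /setP E; apply/setP => z; move: (E z).
  rewrite !in_setI; case: (boolP (z \in B)) => zB; rewrite ?andbT //.
  have := (subsetP VB z, subsetP WB z, subsetP SV z, subsetP SW z).
  rewrite in_setU (negPf zB) orbF => -[[[h1 h2] h3] h4] _.
  by apply/idP/idP => [/h1/h4|/h2/h3].
rewrite -(card_in_imset inj); apply/subset_leq_card/subsetP => _ /imsetP[V _ ->].
by rewrite inE subsetIr.
Qed.

(** * Connected sets and segments in a tree *)

Section Tree.

Variables (T : finType) (e : rel T).

Definition ind_rel (V : {set T}) : rel T :=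
  [rel x y | [&& e x y, x \in V & y \in V]].

Definition conn (V : {set T}) : bool :=
  [forall x in V, forall y in V, connect (ind_rel V) x y].

(** In a tree the connected vertex sets are the vertex sets of subtrees (see
[subtree_count2E]); [nconn v u] is thus [f(v,u)], and [nconn v v] is [f(v)]. *)
Definition conn_sets (v u : T) : {set {set T}} :=
  [set V | [&& conn V, v \in V & u \in V]].

Definition nconn (v u : T) : nat := #|conn_sets v u|.

Lemma connP (V : {set T}) :
  reflect {in V &, forall x y, connect (ind_rel V) x y} (conn V).
Proof.
apply: (iffP forall_inP) => [h x y xV yV | h x xV].
  exact: (forall_inP (h x xV)).
by apply/forall_inP => y yV; apply: h.
Qed.

Lemma path_ind_rel (V : {set T}) x p :
  path e x p -> {subset x :: p <= V} -> path (ind_rel V) x p.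
Proof.
elim: p x => //= y p IH x /andP[exy pyp] sub.
have xV : x \in V by apply: sub; rewrite inE eqxx.
have yV : y \in V by apply: sub; rewrite !inE eqxx orbT.
rewrite {1}/ind_rel /= exy xV yV /=; apply: IH => // z zp; apply: sub.
by rewrite inE zp orbT.
Qed.

Lemma ind_rel_path (V : {set T}) x p : path (ind_rel V) x p ->
  path e x p /\ {subset p <= V}.
Proof.
elim: p x => //= y p IH x /andP[/and3P[exy xV yV] /IH[pyp sub]].
split; first by rewrite exy.
by move=> z; rewrite inE => /predU1P[->|/sub].
Qed.

Hypothesis tree_e : is_tree e.

Lemma tree_sym : symmetric e. Proof. by case: tree_e => [] []. Qed.
Lemma tree_irrefl : irreflexive e. Proof. by case: tree_e => [] []. Qed.

Lemma ind_rel_sym (V : {set T}) : symmetric (ind_rel V).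
Proof. by move=> x y; rewrite /ind_rel /= tree_sym [(x \in V) && _]andbC. Qed.

Lemma connect_ind_rel_sym (V : {set T}) : connect_sym (ind_rel V).
Proof. exact/sym_connect_sym/ind_rel_sym. Qed.

(** If two paths from [x] to the same end leave [x] by different edges, their
remainders join two neighbours of [x] without using [x], which closes a cycle. *)
Lemma path_unique x p q :
  path e x p -> path e x q -> uniq (x :: p) -> uniq (x :: q) ->
  last x p = last x q -> p = q.
Proof.
elim: p x q => [|a p IH] x [|b q] //.
- by move=> _ _ _ /= /andP[xq _] lE; move: xq; rewrite lE mem_last.
- by move=> _ _ /= /andP[xq _] _ lE; move: xq; rewrite -lE mem_last.
move=> /= /andP[exa pa] /andP[exb pb] /andP[xp up] /andP[xq uq] lE.
have [ab|ab] := eqVneq a b.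
  by rewrite -ab in pb uq lE *; congr cons; apply: (IH a).
have con r d : path e d r -> x \notin d :: r ->
    connect (ind_rel (~: [set x])) d (last d r).
  move=> pd xd; apply/connectP; exists r => //; apply: path_ind_rel => // z zr.
  by rewrite !inE; apply: contraNneq xd => <-.
have: connect (ind_rel (~: [set x])) a b.
  apply: (connect_trans (con _ _ pa xp)).
  by rewrite lE connect_ind_rel_sym; apply: con.
case/connectP => r /shortenP[s ps us _] lb.
have [pes sub] := ind_rel_path ps.
have sz : 2 < size [:: x, a & s].
  by case: s lb ab {ps us pes sub} => //= ->; rewrite eqxx.
case: tree_e => _ _ /(_ _ sz) []; apply/andP; split.
  by rewrite /= exa /= rcons_path pes /= -lb tree_sym exb.
rewrite cons_uniq us andbT inE negb_or; apply/andP; split.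
  by apply: contraNneq xp => <-; rewrite inE eqxx.
by apply/negP => /sub; rewrite !inE eqxx.
Qed.

Lemma tpath_exists x y : exists p, is_path e x y p.
Proof.
case: tree_e => _ /(_ x y)/connectP[p /shortenP[q pq uq _] ->] _ _.
by exists q; rewrite /is_path pq uq eqxx.
Qed.

Definition tpath x y : seq T := xchoose (tpath_exists x y).

Lemma tpathP x y : is_path e x y (tpath x y).
Proof. exact: xchooseP. Qed.

Lemma tpathE x y p : is_path e x y p -> tpath x y = p.
Proof.
case/and3P => pp /eqP lp up; case/and3P: (tpathP x y) => pq /eqP lq uq.
by apply: (path_unique pq pp uq up); rewrite lq.
Qed.

(** The vertex set of the unique path from [x] to [y].  Locking keeps rewriting
with [inE] from unfolding it. *)
Definition seg x y : {set T} := locked [set z in x :: tpath x y].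

Lemma in_seg x y z : (z \in seg x y) = (z \in x :: tpath x y).
Proof. by rewrite /seg -lock inE. Qed.

Lemma segE x y p : is_path e x y p -> seg x y = [set z in x :: p].
Proof. by move=> h; apply/setP => z; rewrite in_seg (tpathE h) inE. Qed.

Lemma seg_left x y : x \in seg x y.
Proof. by rewrite in_seg mem_head. Qed.

Lemma seg_right x y : y \in seg x y.
Proof.
by rewrite in_seg; case/and3P: (tpathP x y) => _ /eqP lp _; rewrite -{1}lp mem_last.
Qed.

Lemma card_seg x y : #|seg x y| = (size (tpath x y)).+1.
Proof. by rewrite /seg -lock cardsE; case/and3P: (tpathP x y) => _ _ /card_uniqP. Qed.

Lemma dist_seg x y : dist e x y = #|seg x y|.-1.
Proof.
rewrite card_seg /= /dist; set k := size _.
have kT : k < #|T| by rewrite /k -card_seg max_card.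
set a := fun _ => _.
have aE i : a i = (i == k).
  apply/existsP/eqP => [[p /tpathE pE]|->]; first by rewrite /k pE size_tuple.
  by exists (in_tuple (tpath x y)); apply: tpathP.
have hk : has a (iota 0 #|T|).
  by apply/hasP; exists k; rewrite ?aE // mem_iota.
have := nth_find 0 hk; rewrite aE nth_iota ?add0n; first by move/eqP.
by rewrite -{2}(size_iota 0 #|T|) -has_find.
Qed.

(** Connected sets are the convex sets of the tree: this and [conn_seg] make
[seg x y] the smallest connected set through [x] and [y]. *)
Lemma seg_sub (V : {set T}) x y : conn V -> x \in V -> y \in V -> seg x y \subset V.
Proof.
move/connP => h xV yV; case/connectP: (h _ _ xV yV) => p /shortenP[q pq uq _] yE.
have [peq sub] := ind_rel_path pq.
rewrite (@segE _ _ q) /is_path ?peq ?uq ?yE ?eqxx //.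
by apply/subsetP => z; rewrite !inE => /predU1P[->|/sub].
Qed.

Lemma conn_star r (V : {set T}) : {in V, forall y, connect (ind_rel V) r y} -> conn V.
Proof.
move=> h; apply/connP => x y xV yV.
by apply: connect_trans (h y yV); rewrite connect_ind_rel_sym h.
Qed.

Lemma conn_path x p : path e x p -> conn [set z in x :: p].
Proof.
move=> pp; apply: (@conn_star x) => y; rewrite inE => yp.
case/splitPl: yp pp => p1 p2 <-; rewrite cat_path => /andP[p1P _].
apply/connectP; exists p1 => //; apply: path_ind_rel => // z.
by rewrite !inE mem_cat => /predU1P[->|->]; rewrite ?eqxx ?orbT.
Qed.

Lemma conn_seg x y : conn (seg x y).
Proof.
by rewrite (segE (tpathP x y)); case/and3P: (tpathP x y) => h _ _; apply: conn_path.
Qed.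

Lemma conn_rooted r (V : {set T}) : {in V, forall y, seg r y \subset V} -> conn V.
Proof.
move=> h; apply: (@conn_star r) => y yV; apply/connectP.
case/and3P: (tpathP r y) => pp /eqP lp _; exists (tpath r y) => //.
by apply: path_ind_rel => // z zp; apply: (subsetP (h y yV)); rewrite in_seg.
Qed.

Lemma connU r (V W : {set T}) : conn V -> conn W -> r \in V -> r \in W -> conn (V :|: W).
Proof.
move=> cV cW rV rW; apply: (@conn_rooted r) => y; rewrite inE => /orP[yV|yW].
  by apply: subset_trans (subsetUl _ _); apply: seg_sub.
by apply: subset_trans (subsetUr _ _); apply: seg_sub.
Qed.

Lemma segC x y : seg x y = seg y x.
Proof.
by apply/eqP; rewrite eqEsubset !seg_sub ?conn_seg ?seg_left ?seg_right.
Qed.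

Lemma seg_subl x y z : z \in seg x y -> seg x z \subset seg x y.
Proof. by move=> h; rewrite seg_sub ?conn_seg ?seg_left. Qed.

(** With [x] as root, [a \in seg x b] is a partial order on the vertices; this is
its antisymmetry, and [seg_total] says that it is total below a given vertex. *)
Lemma seg_anti x y z : z \in seg x y -> z != y -> y \notin seg x z.
Proof.
rewrite in_seg; case/and3P: (tpathP x y) => pp /eqP lp up zp.
case/splitPl: zp pp lp up => p1 p2 lz; rewrite cat_path last_cat lz.
case/andP=> pp1 pp2 lp up zy; rewrite (@segE _ _ p1); last first.
  by move: up; rewrite /is_path pp1 lz eqxx -cat_cons cat_uniq => /andP[].
move: up; rewrite -cat_cons cat_uniq => /and3P[_ /hasPn h _]; rewrite inE; apply: h.
by case: p2 lp {pp2} zy => [/= ->|a p2 /= <- _]; rewrite ?eqxx // mem_last.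
Qed.

Lemma seg_total r u a b : a \in seg r u -> b \in seg r u ->
  a \in seg r b \/ b \in seg r a.
Proof.
rewrite [a \in seg r u]in_seg [b \in seg r u]in_seg.
case/and3P: (tpathP r u) => pp /eqP lp up zp.
case/splitPl: zp pp lp up => p1 p2 la; rewrite cat_path last_cat la.
case/andP=> pp1 pp2 lp; rewrite -cat_cons mem_cat => up /orP[b1|b2].
  right; rewrite (@segE _ _ p1) ?inE // /is_path pp1 la eqxx.
  by move: up; rewrite cat_uniq => /andP[].
left; case/splitPr: b2 pp2 lp up => q1 q2; rewrite -cat_rcons cat_path.
case/andP=> pq1 _ _; rewrite catA cat_uniq => /andP[up _].
rewrite (@segE _ _ (p1 ++ rcons q1 b)).
  by rewrite inE -cat_cons mem_cat -la mem_last.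
by rewrite /is_path cat_path pp1 la pq1 last_cat last_rcons eqxx.
Qed.

Lemma seg_inj r u a b : a \in seg r u -> b \in seg r u ->
  seg r a = seg r b -> a = b.
Proof.
move=> au bu E; apply/eqP/negPn/negP => ab.
have := @seg_anti r b a; rewrite -E seg_right ab => /(_ isT isT)/negP[].
by rewrite E seg_right.
Qed.

Lemma seg_edge c c' z : e c c' -> c' \notin seg c z ->
  seg c' z = c' |: seg c z.
Proof.
move=> ecc' c'z; case/and3P: (tpathP c z) => pp lp up.
rewrite (@segE _ _ (c :: tpath c z)).
  by apply/setP => y; rewrite !inE in_seg inE.
by move: c'z; rewrite /is_path in_seg cons_uniq /= tree_sym ecc' pp lp => ->.
Qed.

(** The path from [u] to [s] crosses the edge between [c] and [c'] when these
vertices are separated by it, and it contains the paths from [c] to [u] and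
to [s], which share only [c]. *)
Lemma seg_cross c c' u s : e c c' -> c' \notin seg c u -> c' \in seg c s ->
  [/\ c \in seg u s, c' \in seg u s & #|seg c u| + #|seg c s| <= #|seg u s|.+1].
Proof.
move=> ecc' c'u c's.
have c'us : c' \in seg u s.
  have cV : c \in seg u s :|: seg c u by rewrite in_setU seg_left orbT.
  have sV : s \in seg u s :|: seg c u by rewrite in_setU seg_right.
  have := seg_sub
    (connU (conn_seg u s) (conn_seg c u) (seg_left u s) (seg_right c u)) cV sV.
  by move/subsetP/(_ c' c's); rewrite in_setU (negPf c'u) orbF.
have cus : c \in seg u s.
  have : seg c' u \subset seg u s by rewrite seg_sub ?conn_seg ?seg_left.
  by rewrite (seg_edge ecc') // => /subsetP; apply; rewrite in_setU seg_left orbT.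
split => //.
have sub : seg c u :|: seg c s \subset seg u s.
  by rewrite subUset !seg_sub ?conn_seg ?seg_left ?seg_right.
have I1 : #|seg c u :&: seg c s| <= 1.
  rewrite -(cards1 c); apply/subset_leq_card/subsetP => z.
  rewrite !in_setI in_set1 => /andP[zu zs]; apply/negPn/negP => zc.
  case: (seg_total c's zs) => [c'z|].
    by move: c'u; rewrite (subsetP (seg_subl zu)).
  rewrite (@segE _ _ [:: c']); last first.
    rewrite /is_path /= ecc' !eqxx inE /= andbT.
    by apply/negP => /eqP E; move: ecc'; rewrite E tree_irrefl.
  rewrite !inE (negPf zc) /= => /eqP zE; move: c'u; rewrite -zE.
  by rewrite zu.
have := subset_leq_card sub; rewrite cardsU.
have : #|seg c u :&: seg c s| <= #|seg c u| by rewrite subset_leq_card ?subsetIl.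
lia.
Qed.


(** * Subtrees and connected sets *)

Lemma mem_edges x y : ([set x; y] \in edges e) = e x y.
Proof.
apply/imsetP/idP => [[[a b] /= eab] E|exy]; last by exists (x, y); rewrite ?inE.
rewrite inE /= in eab.
have hx : x \in [set a; b] by rewrite -E set21.
have hy : y \in [set a; b] by rewrite -E set22.
have: [set a; b] \subset [set x; y] by rewrite E.
rewrite subUset !sub1set !inE.
case/set2P: hx => ->; case/set2P: hy => -> //.
- by rewrite !orbb => /andP[_ /eqP bE]; rewrite -{2}bE.
- by rewrite tree_sym.
by rewrite !orbb => /andP[/eqP aE _]; rewrite -{1}aE.
Qed.

(** A subtree is induced: an edge between two of its vertices is the unique path
between them, hence the path that connects them inside the subtree. *)
Lemma subtree_edges H : is_subtree e H ->
  H.2 = [set E in edges e | E \subset H.1].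
Proof.
case/and3P => /andP[sub2 /forall_inP sub1] _ /forall_inP con.
apply/eqP; rewrite eqEsubset; apply/andP; split; apply/subsetP => E.
  by move=> EH; rewrite inE (subsetP sub2) ?sub1.
rewrite inE => /andP[Ee]; case/imsetP: (Ee) => [[x y] /=]; rewrite inE /= => exy ->.
rewrite subUset !sub1set => /andP[xV yV].
case/connectP: (forall_inP (con x xV) y yV) => p /shortenP[q pq uq _] yE.
have sub_e : subrel (sub_adj H) e.
  by move=> a b /(subsetP sub2); rewrite mem_edges.
have xy : x != y by apply/eqP => E'; rewrite E' tree_irrefl in exy.
have: q = [:: y].
  apply: (@path_unique x) => //=; rewrite ?exy ?inE ?xy //.
  exact: sub_path sub_e _ _ pq.
by move=> qE; move: pq; rewrite qE /= andbT.
Qed.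

Lemma subtree_conn H : is_subtree e H -> conn H.1.
Proof.
case/and3P => /andP[sub2 /forall_inP sub1] _ /forall_inP con.
apply/connP => x y xV yV.
apply: connect_sub (forall_inP (con x xV) y yV) => a b ab; apply: connect1.
move: (sub1 _ ab) (subsetP sub2 _ ab).
by rewrite mem_edges subUset !sub1set /ind_rel /= => /andP[-> ->] ->.
Qed.

Lemma conn_subtree (V : {set T}) : conn V -> V != set0 ->
  is_subtree e (V, [set E in edges e | E \subset V]).
Proof.
move=> /connP cV V0; apply/and3P; split => //=.
  apply/andP; split; first by apply/subsetP => E; rewrite inE => /andP[].
  by apply/forall_inP => E; rewrite inE => /andP[].
apply/forall_inP => x xV; apply/forall_inP => y yV.
apply: connect_sub (cV x y xV yV) => a b /and3P[eab aV bV]; apply: connect1.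
by rewrite /sub_adj inE mem_edges eab subUset !sub1set aV.
Qed.

Lemma subtree_count2E v u : subtree_count2 e v u = nconn v u.
Proof.
rewrite /subtree_count2 /nconn -(card_in_imset (f := fst)); last first.
  move=> [V E] [V' E']; rewrite !inE /=.
  move=> /and3P[/subtree_edges/= -> _ _] /and3P[/subtree_edges/= -> _ _].
  by move=> ->.
congr #|pred_of_set _|; apply/setP => V; rewrite [RHS]inE; apply/imsetP/and3P.
  by case=> H; rewrite inE => /and3P[/subtree_conn cH vH uH] ->.
case=> cV vV uV; exists (V, [set E in edges e | E \subset V]) => //.
by rewrite inE conn_subtree /= ?vV ?uV //; apply/set0Pn; exists v.
Qed.

Lemma subtree_countE v : subtree_count e v = nconn v v.
Proof.
rewrite -subtree_count2E; congr #|pred_of_set _|.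
by apply/setP => H; rewrite !inE andbb.
Qed.

Lemma nconnC v u : nconn v u = nconn u v.
Proof.
by congr #|pred_of_set _|; apply/setP => V; rewrite !inE [(v \in V) && _]andbC.
Qed.

(** * Comparing numbers of connected sets *)

(** A connected set [I] through [c] is sent to its union with the path [S] from
[c] to [u] and to the number of vertices of [I] on [S].  This is injective:
[I] meets [S] in an initial segment, which the number determines. *)
Lemma nconn_leq_extend x c u : nconn x c <= #|seg c u| * nconn x u.
Proof.
set S := seg c u.
pose F (I : {set T}) := (I :|: S, inord #|I :&: S| : 'I_#|S|.+1).
pose Y := setX (conn_sets x u) [set i : 'I_#|S|.+1 | i != ord0].
have -> : #|S| * nconn x u = #|Y|.
  rewrite cardsX mulnC; congr (_ * _).
  rewrite -[LHS]/#|S|.+1.-1 -[in LHS](card_ord #|S|.+1).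
  by rewrite -(cardsC1 ord0); apply: eq_card => i; rewrite !inE.
suff inj : {in conn_sets x c &, injective F}.
  rewrite /nconn -(card_in_imset inj).
  apply/subset_leq_card/subsetP => _ /imsetP[I hI ->].
  move: hI; rewrite in_set => /and3P[cI xI cvI].
  rewrite !inE /= xI seg_right orbT.
  rewrite (connU cI (conn_seg c u) cvI (seg_left c u)) /=.
  rewrite -val_eqE /= inordK ?ltnS ?subset_leq_card ?subsetIr //.
  rewrite -lt0n card_gt0; apply/set0Pn; exists c.
  by rewrite in_setI cvI seg_left.
move=> I J; rewrite !inE => /and3P[cI _ rI] /and3P[cJ _ rJ] [EU].
move/(congr1 val); rewrite /= !inordK ?ltnS ?subset_leq_card ?subsetIr // => Ec.
(* Both traces are initial segments of the chain S, so one contains the other. *)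
have comp : (I :&: S \subset J :&: S) || (J :&: S \subset I :&: S).
  case: (boolP (I :&: S \subset J :&: S)) => //= /subsetPn[a].
  rewrite !in_setI => /andP[aI aS]; rewrite aS andbT => aJ.
  apply/subsetP => b; rewrite !in_setI => /andP[bJ bS]; rewrite bS andbT.
  case: (seg_total aS bS) => h.
    by case/negP: aJ; apply: (subsetP (seg_sub cJ rJ bJ)).
  exact: (subsetP (seg_sub cI rI aI)).
have EI : I :&: S = J :&: S.
  case/orP: comp => h; apply/eqP; last rewrite eq_sym.
    by rewrite eqEcard h Ec leqnn.
  by rewrite eqEcard h Ec leqnn.
apply/setP => z; move/setP: EU => /(_ z); move/setP: EI => /(_ z).
by rewrite !in_setU !in_setI; case: (z \in S); rewrite ?andbT ?orbF.
Qed.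

(** For a connected set through the end vertex [x] and through [u], deleting [x]
gives a connected set through [s] and [u] that misses [x]. *)
Lemma nconn_delete_leaf u s x : x != u -> x != s ->
  (forall y, x \in seg u y -> y = x) -> s \in seg u x ->
  2 * nconn x u <= nconn s u.
Proof.
move=> xu xs xmax sx.
have sV V : V \in conn_sets x u -> s \in V.
  rewrite inE => /and3P[cV xV uV]; exact: (subsetP (seg_sub cV uV xV)).
have inj : {in conn_sets x u &, injective (fun V => V :\ x)}.
  move=> V W; rewrite !inE => /and3P[_ xV _] /and3P[_ xW _] E.
  by rewrite -(setD1K xV) E setD1K.
have dis : [disjoint conn_sets x u & [set V :\ x | V in conn_sets x u]].
  rewrite -setI_eq0 -subset0; apply/subsetP => V; rewrite in_setI => /andP[].
  rewrite inE => /and3P[_ xV _] /imsetP[W _ E].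
  by move: xV; rewrite E !inE eqxx.
rewrite mul2n -addnn {2}/nconn -(card_in_imset inj) -cardsUI.
move: dis; rewrite -setI_eq0 => /eqP->; rewrite cards0 addn0.
apply/subset_leq_card/subsetP => V; rewrite in_setU => /orP[h|].
  by move: (sV V h); move: h; rewrite !inE => /and3P[-> _ ->] ->.
case/imsetP => W h ->; move: (sV W h); move: h; rewrite !inE.
move=> /and3P[cW xW uW] sW; rewrite uW sW eq_sym xs eq_sym xu /= !andbT.
apply: (@conn_rooted u) => y; rewrite !inE => /andP[yx yW].
apply/subsetP => z zy; rewrite !inE (subsetP (seg_sub cW uW yW)) // andbT.
by apply: contraNneq yx => zx; rewrite (xmax y) // -zx.
Qed.

(** Besides the connected sets through [u] and [s], the paths from [u] that end
between [c] and [s], short of [s], contain [u] and [c]. *)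
Lemma nconn_add_prefixes u c s : c \in seg u s ->
  nconn s u + (#|seg u s| - #|seg u c|) <= nconn c u.
Proof.
move=> cs; pose X := [set w in seg u s | c \in seg u w] :\ s.
(* X is the part of the path from c to s that precedes s. *)
have cX : #|seg u s| - #|seg u c| <= #|X|.
  rewrite leq_subLR.
  have -> : #|seg u c| = #|seg u c :\ c|.+1 by rewrite [LHS](cardsD1 c) seg_right.
  have -> : #|seg u s| = #|seg u s :\ s|.+1 by rewrite [LHS](cardsD1 s) seg_right.
  have [->|sc] := eqVneq s c; first by lia.
  rewrite addSn ltnS; apply: leq_trans (leq_card_setU _ _).
  apply/subset_leq_card/subsetP => w; rewrite !in_setU !in_setD1 in_set.
  case/andP => -> ws; rewrite ws /=.
  have [->|_] /= := eqVneq w c; first by rewrite seg_right.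
  by case: (seg_total cs ws) => ->; rewrite ?orbT.
have inj : {in X &, injective (seg u)}.
  move=> a b; rewrite !in_setD1 !in_set => /and3P[_ ha _] /and3P[_ hb _].
  exact: seg_inj ha hb.
apply: leq_trans (leq_add (leqnn _) cX) _.
rewrite -(card_in_imset inj) -cardsUI.
set I := _ :&: _; have -> : I = set0.
  apply/eqP; rewrite -subset0; apply/subsetP => V; rewrite in_setI => /andP[].
  rewrite in_set => /and3P[_ sV _] /imsetP[w].
  rewrite in_setD1 in_set => /and3P[ws wu _] E.
  by move: (seg_anti wu ws); rewrite -E sV.
rewrite cards0 addn0; apply/subset_leq_card/subsetP => V.
rewrite in_setU => /orP[|/imsetP[w]].
  rewrite !in_set => /and3P[cV sV uV]; rewrite cV uV andbT /=.
  exact: (subsetP (seg_sub cV uV sV)).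
by rewrite in_setD1 in_set => /and3P[_ _ cw] ->; rewrite in_set conn_seg cw seg_left.
Qed.

Lemma nconn_leq_exp s u : nconn s u <= 2 ^ (#|T| - #|seg u s|).
Proof.
have -> : #|T| - #|seg u s| = #|~: seg u s| by rewrite [RHS]cardsCs setCK.
apply: (@card_sets_between _ (seg u s)) => V.
rewrite in_set => /and3P[cV sV uV]; split; first exact: seg_sub.
by rewrite setUCr subsetT.
Qed.

Lemma nconn_avoid_split a b :
  #|[set V in conn_sets a a | b \notin V]| + nconn a b = nconn a a.
Proof.
rewrite addnC -[RHS](cardsID [set V : {set T} | b \in V]); congr (_ + _).
  by apply: eq_card => V; rewrite !inE; case: (conn V); case: (a \in V); case: (b \in V).
by apply: eq_card => V; rewrite !inE andbC.
Qed.

(** The sets through both vertices contribute equally to [f(a)] and [f(b)]. *)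
Lemma nconn_leq_avoid a b :
  (nconn a a <= nconn b b) =
  (#|[set V in conn_sets a a | b \notin V]| <= #|[set V in conn_sets b b | a \notin V]|).
Proof. by rewrite -(nconn_avoid_split a b) -(nconn_avoid_split b a) nconnC leq_add2r. Qed.

(** A connected set that contains the leaf [s] but not its neighbour [s'] is [s]
alone. *)
Lemma nconn_leaf_leq s' s u : e s' s -> s \notin seg s' u ->
  (forall y, s \in seg u y -> y = s) -> nconn s s <= nconn s' s'.
Proof.
move=> es's ssu smax; rewrite nconn_leq_avoid.
have -> : [set V in conn_sets s s | s' \notin V] = [set [set s]].
  apply/setP => V; rewrite !inE andbb; apply/idP/eqP => [|->]; last first.
    rewrite !inE eqxx andbT /=; apply/andP; split.
      apply: (@conn_rooted s) => y; rewrite inE => /eqP->.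
      by rewrite (@segE s s [::]) ?/is_path ?eqxx //=; apply/subsetP => z; rewrite !inE.
    by apply/eqP => E; move: es's; rewrite E tree_irrefl.
  case/andP => /andP[cV sV] s'V; apply/setP => y; rewrite in_set1.
  apply/idP/eqP => [yV|->//]; apply: smax.
  have [h|h] := boolP (s \in seg s' y).
    have [_] := seg_cross es's ssu h; by [].
  move: s'V; rewrite (subsetP (seg_sub cV sV yV)) //.
  by rewrite (seg_edge es's h) in_setU seg_left orbT.
rewrite cards1 card_gt0; apply/set0Pn; exists (seg s' u).
by rewrite !in_set conn_seg seg_left ssu.
Qed.

(** Cut the edge between [s'] and [s].  The left-hand side of the hypothesis bounds
the number of sets that stay on the side of [s], and the right-hand side is a
number of paths that start at [s'] on the other side. *)
Lemma nconn_leq_of_small_side s' s u : e s' s -> s \notin seg s' u ->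
  2 ^ (#|T| - #|seg s' u| - 1) <= #|seg s' u| -> nconn s s <= nconn s' s'.
Proof.
move=> es's ssu hc; rewrite nconn_leq_avoid.
apply: (@leq_trans (2 ^ (#|T| - #|seg s' u| - 1))).
  have -> : #|T| - #|seg s' u| - 1 = #|~: (s |: seg s' u)|.
    by rewrite [RHS]cardsCs setCK cardsU1 ssu; lia.
  apply: (@card_sets_between _ [set s]) => V.
  rewrite !in_set => /andP[/and3P[cV sV _] s'V]; rewrite sub1set; split => //.
  apply/subsetP => y yV; rewrite in_setU in_set1 in_setC in_setU1.
  case: eqP => //= _; apply: contra s'V => yu.
  apply: (subsetP (seg_sub cV sV yV)); rewrite (seg_edge es's).
    by rewrite in_setU seg_left orbT.
  by apply: contra ssu; apply: (subsetP (seg_subl yu)).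
apply: (leq_trans hc).
have inj : {in seg s' u &, injective (seg s')} by move=> a b; apply: seg_inj.
rewrite -(card_in_imset inj); apply/subset_leq_card/subsetP => V /imsetP[y yu ->].
rewrite !in_set conn_seg !seg_left /=.
by apply: contra ssu; apply: (subsetP (seg_subl yu)).
Qed.


(** * The distance between core and core center *)

Lemma seg_id x : seg x x = [set x].
Proof.
by rewrite (@segE x x [::]) ?/is_path ?eqxx //=; apply/setP => z; rewrite !inE.
Qed.

Lemma seg_next x y : x != y -> exists x', [/\ e x x', x \notin seg x' y & x' \in seg x y].
Proof.
move=> xy; have:= tpathP x y; case: (tpath x y) (in_seg x y) => [|a p] E.
  by case/and3P => _ /=; rewrite (negPf xy).
case/and3P => /= /andP[exa pp] lp /andP[xp up]; exists a; split => //.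
  by rewrite (@segE _ _ p) ?inE // /is_path pp lp.
by rewrite E !inE eqxx orbT.
Qed.

Lemma card_seg_edge c c' z : e c c' -> c' \notin seg c z ->
  #|seg c' z| = #|seg c z|.+1.
Proof. by move=> ecc' h; rewrite (seg_edge ecc' h) cardsU1 h. Qed.

Lemma nconn_mono x y z : z \in seg x y -> nconn x y <= nconn z y.
Proof.
move=> h; apply/subset_leq_card/subsetP => V; rewrite !inE => /and3P[cV xV yV].
by rewrite cV yV andbT /=; apply: (subsetP (seg_sub cV xV yV)).
Qed.

Lemma ecc_leq v u : ecc_subtree_number e v <= nconn v u.
Proof. by rewrite -subtree_count2E; apply: bigmin_leq. Qed.

Lemma ecc_attained v : exists u, ecc_subtree_number e v = nconn v u.
Proof.
apply: (big_ind (fun x => exists u, x = nconn v u)).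
- by exists v; rewrite subtree_count2E.
- by move=> x y [u ->] [w ->]; rewrite /minn; case: ifP => _; [exists u | exists w].
- by move=> u _; exists u; rewrite subtree_count2E.
Qed.

Lemma coreP v : reflect (forall u, nconn u u <= nconn v v) (v \in subtree_core e).
Proof.
rewrite inE; apply: (iffP forallP) => h u; move: (h u); by rewrite !subtree_countE.
Qed.

Lemma core_lt s s' : s \in subtree_core e -> s' \notin subtree_core e ->
  nconn s' s' < nconn s s.
Proof.
move=> /coreP hs; rewrite ltnNge; apply: contra => h.
by apply/coreP => u; apply: leq_trans (hs u) h.
Qed.

Lemma center_lt c c' : c \in core_center e -> c' \notin core_center e ->
  ecc_subtree_number e c' < ecc_subtree_number e c.
Proof.
rewrite inE => /forallP hc; rewrite ltnNge; apply: contra => h.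
by rewrite inE; apply/forallP => u; apply: leq_trans (hc u) h.
Qed.

Lemma core_neq0 : exists s, s \in subtree_core e.
Proof.
case: tree_e => _ _ _ /card_gt0P[x _].
case: (@arg_maxnP _ x predT (subtree_count e)) => // s _ h; exists s.
by rewrite inE; apply/forallP => u; apply: h.
Qed.

Lemma center_neq0 : exists c, c \in core_center e.
Proof.
case: tree_e => _ _ _ /card_gt0P[x _].
case: (@arg_maxnP _ x predT (ecc_subtree_number e)) => // s _ h; exists s.
by rewrite inE; apply/forallP => u; apply: h.
Qed.

(** Extending the path from [u] to [s] as far as possible ends at such an [x]. *)
Lemma distal_vertex u s : exists x, s \in seg u x /\ forall y, x \in seg u y -> y = x.
Proof.
case: (@arg_maxnP _ s (fun x => s \in seg u x) (fun x => #|seg u x|)).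
  exact: seg_right.
move=> x sx xmax; exists x; split => // y xy; apply/eqP/negPn/negP => yx.
have sub := seg_subl xy.
have := xmax y (subsetP sub _ sx); apply/negP; rewrite -ltnNge.
apply: proper_card; apply/properP; split => //; exists y; rewrite ?seg_right //.
by apply: seg_anti => //; rewrite eq_sym.
Qed.

(** The extremal inequality: [h] counts the vertices besides a path with [k + 3]
vertices, and [k <= 2 ^ (h - 1)] is the inequality defining [g0] at [h]. *)
Lemma separated_core_center c s k :
  c \in core_center e -> s \in subtree_core e ->
  (forall c' s', c' \in core_center e -> s' \in subtree_core e ->
     #|seg c s| <= #|seg c' s'|) ->
  #|seg c s| = k.+1 -> 0 < k ->
  exists h, [/\ #|T| = k + 3 + h, 0 < h, k <= 2 ^ (h - 1) & #|T| = 7 -> k <= 1].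
Proof.
move=> cC sS cs_min cs_k k_gt0.
have cs : c != s by apply/eqP => E; move: cs_k; rewrite E seg_id cards1; lia.
have [c' [ecc' cc's c's]] := seg_next cs.
have ec'c : e c' c by rewrite tree_sym.
have [s' [ess' ss'c s'c]] : exists s', [/\ e s s', s \notin seg s' c & s' \in seg s c].
  by apply: seg_next; rewrite eq_sym.
have es's : e s' s by rewrite tree_sym.
have c'C : c' \notin core_center e.
  by apply/negP => /cs_min/(_ sS); rewrite (card_seg_edge ec'c cc's) ltnn.
have s'S : s' \notin subtree_core e.
  apply/negP => /(cs_min _ _ cC).
  by rewrite segC (card_seg_edge es's ss'c) [seg c s']segC ltnn.
have [u uE] := ecc_attained c'.
have hu x : nconn c' u < nconn c x.
  by rewrite -uE; apply: leq_trans (center_lt cC c'C) (ecc_leq c x).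
have c'u : c' \notin seg c u.
  by apply/negP => /nconn_mono; rewrite leqNgt hu.
have [cus c'us card_us] := seg_cross ecc' c'u c's.
have s'us : s' \in seg u s.
  rewrite segC; apply: (subsetP _ _ s'c); apply: seg_sub (conn_seg _ _) (seg_left _ _) _.
  by rewrite segC.
have ssu : s \notin seg s' u.
  rewrite segC; apply: seg_anti => //.
  by apply/eqP => E; move: ess'; rewrite E tree_irrefl.
have s'_lt := core_lt sS s'S.
have [x [sx xmax]] := distal_vertex u s.
have xs : x != s.
  apply/eqP => E; move: s'_lt; rewrite ltnNge (nconn_leaf_leq es's ssu) //.
  by rewrite -E.
have xu : x != u.
  apply/eqP => E; move: sx; rewrite E seg_id inE => /eqP su.
  by move: c'us c'u; rewrite su seg_id inE => /eqP->; rewrite seg_right.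
have h1 : nconn c' u < #|seg c u| * nconn x u.
  by apply: leq_trans (hu x) _; rewrite nconnC nconn_leq_extend.
have h2 := nconn_delete_leaf xu xs xmax sx.
have h3 := nconn_add_prefixes c'us.
rewrite [seg u c']segC (card_seg_edge ecc' c'u) in h3.
have h4 := nconn_leq_exp s u.
have usT : #|seg u s| < #|T|.
  rewrite -cardsT; apply: proper_card; apply/properP; split; first exact: subsetT.
  by exists x; rewrite ?inE //; apply: seg_anti; rewrite // eq_sym.
have h5 : #|T| = 7 -> k = 2 -> 3 <= #|seg c u| -> False.
  move=> T7 k2 d3; move: s'_lt; rewrite ltnNge (nconn_leq_of_small_side es's ssu) // T7.
  have := card_seg_edge es's ssu; rewrite [seg s u]segC.
  move: usT card_us d3; rewrite T7 cs_k k2.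
  move: #|seg s' u| #|seg c u| #|seg u s| => b d a; clear => a7 da d3 aE.
  have : (b == 4) || (b == 5) by lia.
  by case/orP => /eqP->.
move: h1 h2 h3 h4 usT card_us h5; rewrite cs_k.
move: #|T| #|seg c u| #|seg u s| (nconn c' u) (nconn x u) (nconn s u).
move=> n d a N Nx K; move: k_gt0; clear => k_gt0 h1 h2 h3 h4 a_n da h5.
(* The four estimates combine; d >= 3 follows from the resulting inequality. *)
have hK : K.*2 + (k - 1).*2 < d * K.
  have : N.*2 < d * K by rewrite -!mul2n in h2 *; nia.
  lia.
have d3 : 3 <= d by move: hK; case: d {h1 h3 da h5} => [|[|[|d]]] //; lia.
have hK2 : (k - 1).*2 < (d - 2) * K by rewrite mulnBl; lia.
(* Here d - 2 <= 2 ^ (d - 3) absorbs the vertices of a longer path to u. *)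
have hk : k <= 2 ^ (n - k - 3 - 1).
  have : (k - 1).*2 < 2 ^ (n - k - 3).
    apply: (leq_trans hK2).
    have -> : n - k - 3 = (d - 3) + (n - d - k) by lia.
    rewrite expnD; apply: leq_mul.
      by have := ltn_expl (d - 3) (isT : 1 < 2); lia.
    by apply: (leq_trans h4); rewrite leq_exp2l //; lia.
  have -> : 2 ^ (n - k - 3) = (2 ^ (n - k - 3 - 1)).*2.
    by rewrite -mul2n -expnS; congr (_ ^ _); lia.
  by rewrite ltn_double; move: (2 ^ _) => X; move: k_gt0; clear => *; lia.
exists (n - k - 3); split=> //; [lia | lia | move=> n7].
have : k <= 3 by lia.
have : k != 3 by apply: contraTneq hk => ->; rewrite n7.
have : k != 2 by apply/eqP => /(h5 n7)/(_ d3).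
by clear; case: k => [|[|[|[|k]]]].
Qed.

Lemma set_dist_leq (X Y : {set T}) x y :
  x \in X -> y \in Y -> set_dist e X Y <= dist e x y.
Proof.
move=> xX yY; apply: (leq_trans (bigmin_leq _ _ xX)); exact: bigmin_leq.
Qed.

Lemma set_dist_geq (X Y : {set T}) m : m <= #|T| ->
  (forall x y, x \in X -> y \in Y -> m <= dist e x y) -> m <= set_dist e X Y.
Proof.
by move=> mT h; apply: bigmin_geq => // x xX; apply: bigmin_geq => // y yY; apply: h.
Qed.

Lemma core_center_set_dist_leq (g0 : nat) :
  6 <= #|T| -> 2 <= g0 -> #|T| - 3 <= 2 ^ (g0 - 1) + g0 ->
  (forall g : nat, 0 < g -> #|T| - 3 <= 2 ^ (g - 1) + g -> g0 <= g) ->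
  set_dist e (subtree_core e) (core_center e) <= if #|T| == 7 then 1 else #|T| - g0 - 3.
Proof.
move=> n6 g2 g0P g0_min.
have [s0 s0S] := core_neq0; have [c0 c0C] := center_neq0.
pose P (p : T * T) := (p.1 \in core_center e) && (p.2 \in subtree_core e).
have P0 : P (c0, s0) by rewrite /P c0C.
case: (@arg_minnP _ _ P (fun p => #|seg p.1 p.2|) P0) => -[c s] /andP[/= cC sS] cs_min.
apply: (leq_trans (set_dist_leq sS cC)); rewrite dist_seg segC.
case E: #|seg c s| => [|k] //=.
have [->//|k_gt0] := posnP k.
have [|h [nE h0 kh h7]] := separated_core_center cC sS _ E k_gt0.
  by move=> c' s' c'C s'S; apply: (cs_min (c', s')); rewrite /P c'C.
case: eqP => [/h7//|_].
have : g0 <= h.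
  by apply: g0_min => //; rewrite nE; move: kh; move: (2 ^ _) => X; clear => *; lia.
by rewrite nE; clear => *; lia.
Qed.


(** * The path-star tree *)

Section PathStar.

(* [lab] numbers the vertices as in [path_star], with inverse [vx]: the spine has
   the numbers below [m], and [m.-1] is the hub. *)
Variables (m g : nat) (lab : T -> nat) (vx : nat -> T).

Hypothesis lab_lt : forall x, lab x < m + g.
Hypothesis labK : forall x, vx (lab x) = x.
Hypothesis vxK : forall i, i < m + g -> lab (vx i) = i.
Hypothesis e_lab : forall x y, e x y =
  path_star_arc (m + g) g (lab x) (lab y) || path_star_arc (m + g) g (lab y) (lab x).
Hypothesis m_ge4 : 4 <= m.
Hypothesis g_ge2 : 2 <= g.
Hypothesis m_le : m - 3 <= 2 ^ (g - 1).

Definition hub := vx m.-1.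
Definition pendants : {set T} := [set x | m <= lab x].
(** Distance from vertex [0]: all pendant vertices are at distance [m]. *)
Definition phi x := minn (lab x) m.

Lemma arcE i j : path_star_arc (m + g) g i j =
  ((j < m) && (j == i.+1)) || ((m <= j) && (i == m.-1)).
Proof. by rewrite /path_star_arc addnK. Qed.

Lemma lab_vx i : i < m -> lab (vx i) = i.
Proof. by move=> im; apply: vxK; rewrite (leq_trans im) ?leq_addr. Qed.

Lemma phi_vx i : i < m -> phi (vx i) = i.
Proof. by move=> im; rewrite /phi lab_vx //; lia. Qed.

Lemma phi_eq x t : t < m -> phi x = t -> x = vx t.
Proof. by move=> tm h; rewrite -(labK x); congr vx; move: h; rewrite /phi; lia. Qed.

Lemma e_phi x y : e x y -> phi y <= (phi x).+1.
Proof. by rewrite e_lab !arcE /phi; move: m_ge4; clear => *; lia. Qed.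

(** [phi] changes by at most one along an edge and takes the value [t < m] only at
[vx t], so a connected set cannot jump over [vx t]. *)
Lemma conn_sep (V : {set T}) x y t : conn V -> x \in V -> y \in V ->
  phi x <= t <= phi y -> t < m -> vx t \in V.
Proof.
move=> /connP cV xV yV /andP[xt ty] tm; apply/negPn/negP => tV.
have neq z : z \in V -> phi z != t.
  by move=> zV; apply: contraNneq tV => /(phi_eq tm) <-.
have inv p z : path (ind_rel V) z p -> phi z < t -> phi (last z p) < t.
  elim: p z => //= a p IH z /andP[/and3P[za zV aV] pp] zt; apply: IH => //.
  by rewrite ltn_neqAle neq //; apply: leq_trans (e_phi za) zt.
case/connectP: (cV x y xV yV) => p pp yE; move: ty; rewrite leqNgt yE inv //.
by rewrite ltn_neqAle neq.
Qed.

Lemma phi_dist x y : phi x <= phi y + dist e x y.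
Proof.
rewrite dist_seg card_seg /=; case/and3P: (tpathP x y) => + /eqP + _.
move: (tpath x y) => p pp <-; elim: p x pp => [|a p IH] x /=; first by rewrite addn0.
case/andP=> xa /IH h; rewrite tree_sym in xa; move: (e_phi xa) h.
by clear => *; lia.
Qed.

Lemma card_pendants : #|pendants| = g.
Proof.
have mem (i : 'I_g) : m + i < m + g by rewrite ltn_add2l.
have inj : injective (fun i : 'I_g => vx (m + i)).
  move=> i j /(congr1 lab); rewrite !vxK // => /addnI; exact: val_inj.
rewrite -[RHS]card_ord -(card_imset _ inj); apply: eq_card => x; rewrite inE.
apply/idP/imsetP => [mx|[i _ ->]]; last by rewrite vxK // leq_addr.
have xg : lab x - m < g by move: (lab_lt x); lia.
by exists (Ordinal xg) => //=; rewrite subnKC // labK.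
Qed.

(** With [S] a set of pendant vertices, these are the connected sets that contain
the hub. *)
Definition broom j (S : {set T}) : {set T} := [set x | j <= lab x < m] :|: S.

Lemma e_next i : i.+1 < m -> e (vx i.+1) (vx i).
Proof. by move=> im; rewrite e_lab !lab_vx ?arcE ?im ?eqxx ?orbT // ltnW. Qed.

Lemma e_hub x : x \in pendants -> e hub x.
Proof.
by rewrite inE e_lab !arcE /hub lab_vx ?eqxx => [->|]; rewrite ?orbT //; lia.
Qed.

Lemma hub_lab : lab hub = m.-1.
Proof. by rewrite lab_vx //; lia. Qed.

(** Each vertex of the spine part reaches the hub by induction on its distance to
the hub. *)
Lemma conn_broom j (S : {set T}) : j < m -> S \subset pendants -> conn (broom j S).
Proof.
move=> jm /subsetP Sp; apply: (@conn_star hub).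
have hubW : hub \in broom j S by rewrite !inE hub_lab; apply/orP; left; lia.
suff con d y : lab y + d = m.-1 -> j <= lab y -> connect (ind_rel (broom j S)) hub y.
  move=> y; rewrite !inE => /orP[/andP[jy ym]|yS].
    by apply: (con (m.-1 - lab y)) => //; lia.
  apply: connect1; rewrite /ind_rel /= e_hub ?Sp // hubW.
  by rewrite !inE yS orbT.
elim: d y => [|d IH] y hd jy.
  by rewrite -(labK y) -[lab y]addn0 hd connect0.
have ym : (lab y).+1 < m by lia.
have lv : lab (vx (lab y).+1) = (lab y).+1 by rewrite lab_vx.
apply: (connect_trans (IH (vx (lab y).+1) _ _)); rewrite ?lv; try lia.
apply: connect1; rewrite /ind_rel /= -{2}(labK y) e_next // !inE lv ym (ltnW ym) jy.
by rewrite leqW.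
Qed.

Lemma broom_pend j (S : {set T}) : S \subset pendants -> broom j S :&: pendants = S.
Proof.
move=> /subsetP Sp; apply/setP => x; rewrite !inE.
case: (boolP (x \in S)) => [/Sp|_]; rewrite ?inE ?orbT //= orbF.
by move: m_ge4; clear => *; lia.
Qed.

Lemma broom_leq j j' (S S' : {set T}) : S' \subset pendants -> j < m ->
  broom j S = broom j' S' -> j' <= j.
Proof.
move=> /subsetP Sp jm /setP/(_ (vx j)); rewrite !inE lab_vx // leqnn jm /=.
by rewrite andbT; case: leqP => //= _ /esym/Sp; rewrite inE lab_vx // leqNgt jm.
Qed.

(** Brooms with distinct parameters are distinct: [broom_leq] recovers [j] and
[broom_pend] recovers the pendant part.  Exponential lower bounds below count
such families; [A] is the set of prescribed pendant vertices. *)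
Lemma card_brooms (F : {set {set T}}) j0 k (A B : {set T}) :
  j0 + k <= m -> A \subset pendants -> B \subset pendants :\: A ->
  (forall j (S : {set T}), j0 <= j < j0 + k -> S \subset B -> broom j (A :|: S) \in F) ->
  k * 2 ^ #|B| <= #|F|.
Proof.
move=> km Ap; rewrite subsetD => /andP[Bp AB] hF.
pose f (q : 'I_k * {set T}) := broom (j0 + q.1) (A :|: q.2).
pose X := setX [set: 'I_k] (powerset B).
have -> : k * 2 ^ #|B| = #|X| by rewrite cardsX cardsT card_ord card_powerset.
have sp (S : {set T}) : S \subset B -> A :|: S \subset pendants.
  by move=> SB; rewrite subUset Ap (subset_trans SB).
have lt (j : 'I_k) : j0 + j < m by apply: leq_trans km; rewrite ltn_add2l.
have inj : {in X &, injective f}.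
  move=> [j S] [j' S']; rewrite !inE /= /f /= => SB S'B E.
  congr pair.
    have := broom_leq (sp _ SB) (lt j') (esym E).
    have := broom_leq (sp _ S'B) (lt j) E.
    by rewrite !leq_add2l => h h'; apply/val_inj/eqP; rewrite eqn_leq h'.
  have : A :|: S = A :|: S'.
    by rewrite -(broom_pend (j0 + j) (sp _ SB)) E broom_pend ?sp.
  move/setP => ES; apply/setP => x; move: (ES x); rewrite !inE.
  case: (boolP (x \in A)) => //= xA _.
  have xB : x \notin B by move: AB; rewrite disjoint_sym => /disjointFr ->.
  by rewrite (contraNF (subsetP SB x) xB) (contraNF (subsetP S'B x) xB).
rewrite -(card_in_imset inj); apply/subset_leq_card/subsetP => _ /imsetP[[j S] h ->].
rewrite !inE /= in h; apply: hF => //=; rewrite leq_addr ltn_add2l; exact: ltn_ord.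
Qed.

Lemma nconn_hub_end : 2 ^ g <= nconn hub (vx 0).
Proof.
rewrite -[2 ^ g]mul1n -card_pendants.
apply: (@card_brooms _ 0 1 set0 pendants); rewrite ?sub0set ?setD0 //; first lia.
case=> // S _ Sp; rewrite inE set0U conn_broom //; last lia.
by rewrite !inE hub_lab lab_vx //; lia.
Qed.

Lemma nconn_pendant p : p \in pendants -> 3 * 2 ^ g.-1 <= nconn (vx 2) p.
Proof.
move=> pp; have -> : g.-1 = #|pendants :\ p|.
  by have := cardsD1 p pendants; rewrite pp card_pendants => ->.
apply: (@card_brooms _ 0 3 [set p]); rewrite ?sub1set //; first lia.
move=> j S j3 Sp; rewrite inE conn_broom; first last.
- by rewrite subUset sub1set pp (subset_trans Sp) ?subsetDl.
- lia.
by rewrite !inE lab_vx ?eqxx ?orbT //; lia.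
Qed.

Lemma seg_end2 : seg (vx 0) (vx 2) = [set z in [:: vx 0; vx 1; vx 2]].
Proof.
apply: segE; rewrite /is_path /= tree_sym e_next; last lia.
rewrite tree_sym e_next ?eqxx; last lia.
have neq i j : i < m -> j < m -> i != j -> vx i != vx j.
  by move=> im jm; apply: contraNneq => /(congr1 lab); rewrite !lab_vx // => ->.
by rewrite /= !inE !negb_or !neq //; lia.
Qed.

(** Add to the [2 ^ g] brooms through [0] the [m - 3] initial segments of the
spine that contain [2] and stop before the hub. *)
Lemma nconn_end_geq : 2 ^ g + (m - 3) <= nconn (vx 2) (vx 0).
Proof.
have p0 : phi (vx 0) = 0 by rewrite phi_vx //; lia.
have ph : phi hub = m.-1 by rewrite phi_vx //; lia.
have h2 : vx 2 \in seg (vx 0) hub.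
  apply: (conn_sep (conn_seg _ _) (seg_left _ _) (seg_right _ _)).
    by rewrite p0 ph; lia.
  lia.
apply: leq_trans (nconn_add_prefixes h2); apply: leq_add; first exact: nconn_hub_end.
have := phi_dist hub (vx 0); rewrite ph p0 dist_seg [seg hub _]segC => hd.
have : #|seg (vx 0) (vx 2)| <= 3.
  by rewrite seg_end2 cardsE; apply: (leq_trans (card_size _)).
move: m_ge4 hd; clear => *; lia.
Qed.

(** For the eccentric subtree number of [vx 2] only [u = vx 0] and the pendant
vertices matter, since going outwards decreases the number of sets.  A pendant
vertex gives [3 * 2 ^ (g - 1)], and [m - 3 <= 2 ^ (g - 1)]. *)
Lemma nconn_mid_geq u : 2 ^ g + (m - 3) <= nconn (vx 2) u.
Proof.
have p2 : phi (vx 2) = 2 by rewrite phi_vx //; lia.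
case: (leqP (phi u) 2) => hu.
  apply: (leq_trans nconn_end_geq); apply/subset_leq_card/subsetP => V.
  rewrite !inE => /and3P[cV V2 V0]; rewrite cV V2 /=.
  have um : phi u < m by move: m_ge4 hu; clear => *; lia.
  rewrite (phi_eq um erefl); apply: (conn_sep cV V0 V2) => //.
  by rewrite p2 hu phi_vx //; lia.
have [p pp hp] : exists2 p, p \in pendants & u \notin pendants \/ u = p.
  case: (boolP (u \in pendants)) => up; first by exists u => //; right.
  have /card_gt0P[p pp] : 0 < #|pendants| by rewrite card_pendants; lia.
  by exists p => //; left.
apply: (@leq_trans (nconn (vx 2) p)).
  apply: leq_trans (nconn_pendant pp).
  have -> : 2 ^ g = 2 * 2 ^ g.-1 by rewrite -expnS; congr (2 ^ _); lia.
  move: m_le; rewrite subn1; move: (2 ^ g.-1) => X; clear => *; lia.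
case: hp => [up|->//]; apply/subset_leq_card/subsetP => V.
rewrite !inE => /and3P[cV V2 Vp]; rewrite cV V2 /=.
rewrite inE -ltnNge in up; rewrite inE in pp.
have um : phi u < m by move: up; rewrite /phi; clear => *; lia.
rewrite (phi_eq um erefl); apply: (conn_sep cV V2 Vp) => //.
by rewrite p2; move: up pp hu; rewrite /phi; clear => *; lia.
Qed.

(** A connected set through [0] and [2] that contains the hub contains the spine,
so its pendant vertices determine it; otherwise it is an initial segment of the
spine. *)
Lemma nconn_end_leq : nconn (vx 2) (vx 0) <= 2 ^ g + (m - 3).
Proof.
have p2 : phi (vx 2) = 2 by rewrite phi_vx //; lia.
have p0 : phi (vx 0) = 0 by rewrite phi_vx //; lia.
have ph : phi hub = m.-1 by rewrite phi_vx //; lia.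
rewrite /nconn -(cardsID [set V : {set T} | hub \in V]); apply: leq_add.
  rewrite -card_pendants; apply: (@card_sets_between _ [set x | lab x < m]) => V.
  rewrite !inE => /andP[/and3P[cV V2 V0] Vh]; split; apply/subsetP => x; last first.
    by rewrite !inE => _; case: leqP.
  rewrite inE => xm; have xm' : phi x < m by rewrite /phi; lia.
  rewrite (phi_eq xm' erefl); apply: (conn_sep cV V0 Vh) => //.
  by rewrite p0 ph; move: xm'; clear => *; lia.
pose f (i : 'I_(m - 3)) := [set x | lab x <= i + 2].
apply: (@leq_trans #|f @: [set: 'I_(m - 3)]|); last first.
  by rewrite (leq_trans (leq_imset_card _ _)) // cardsT card_ord.
apply/subset_leq_card/subsetP => V; rewrite !inE => /and4P[Vh cV V2 V0].
case: (@arg_maxnP _ (vx 2) (mem V) lab V2) => z zV zmax.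
have zm : lab z < m.-1.
  rewrite ltnNge; apply: contra Vh => zm; apply: (conn_sep cV V0 zV); last lia.
  by rewrite p0 /phi; move: zm m_ge4; clear => *; lia.
have z2 : 2 <= lab z by have := zmax _ V2; rewrite lab_vx //; lia.
have iz : lab z - 2 < m - 3 by move: zm z2; clear => *; lia.
apply/imsetP; exists (Ordinal iz) => //; apply/setP => x; rewrite inE /= subnK //.
apply/idP/idP => [/zmax//|xz].
have xm : phi x < m by rewrite /phi; lia.
rewrite (phi_eq xm erefl); apply: (conn_sep cV V0 zV) => //.
by rewrite p0 /phi; move: xz; clear => *; lia.
Qed.

(** A connected set through [1] and a pendant vertex [p] contains all of the spine
except possibly [0], so [0] and the [g - 1] other pendant vertices are free. *)
Lemma nconn_near_end p : p \in pendants -> nconn (vx 1) p <= 2 ^ g.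
Proof.
move=> pp; have p1 : phi (vx 1) = 1 by rewrite phi_vx //; lia.
pose B := vx 0 |: pendants :\ p.
have -> : g = #|B|.
  rewrite cardsU1 !inE lab_vx; last lia.
  have -> : (m <= 0) = false by lia.
  by rewrite andbF -[LHS]card_pendants (cardsD1 p) pp.
apply: (@card_sets_between _ (p |: [set x | 1 <= lab x < m])) => V.
rewrite inE => /and3P[cV V1 Vp]; rewrite !inE in pp; split; apply/subsetP => x.
  rewrite !inE => /orP[/eqP->//|/andP[x1 xm]].
  have xm' : phi x < m by rewrite /phi; lia.
  rewrite (phi_eq xm' erefl); apply: (conn_sep cV V1 Vp) => //.
  by rewrite p1 /phi; move: x1 pp xm; clear => *; lia.
move=> _; rewrite !inE; have [//|_ /=] := eqVneq x p.
case: (posnP (lab x)) => [x0|x1]; last by move: x1; clear => *; lia.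
by rewrite -x0 labK eqxx orbT.
Qed.

(** A vertex before [2] is beaten through a pendant vertex, one beyond [2]
through [0]. *)
Lemma center_path_star v : v \in core_center e -> v = vx 2.
Proof.
rewrite inE => /forallP/(_ (vx 2)) hv.
have {hv} : 2 ^ g + (m - 3) <= ecc_subtree_number e v.
  apply: leq_trans hv; have [u ->] := ecc_attained (vx 2); exact: nconn_mid_geq.
have /card_gt0P[p pp] : 0 < #|pendants| by rewrite card_pendants; lia.
have php : phi p = m by move: pp; rewrite inE /phi; clear => *; lia.
have p1 : phi (vx 1) = 1 by rewrite phi_vx //; lia.
have p0 : phi (vx 0) = 0 by rewrite phi_vx //; lia.
case: (ltngtP (phi v) 2) => hv; last by move=> _; apply: phi_eq => //; lia.
  suff : ecc_subtree_number e v <= 2 ^ g by move: m_ge4; clear => *; lia.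
  apply: leq_trans (nconn_near_end pp); apply: (leq_trans (ecc_leq v p)).
  apply/subset_leq_card/subsetP => V; rewrite !inE => /and3P[cV Vv Vp].
  rewrite cV Vp andbT /=; apply: (conn_sep cV Vv Vp); last lia.
  by rewrite php; move: hv m_ge4; clear => *; lia.
rewrite leqNgt => /negP[]; apply: leq_ltn_trans (ecc_leq v (vx 0)) _.
apply: leq_trans nconn_end_leq; apply: proper_card; apply/properP; split.
  apply/subsetP => V; rewrite !inE => /and3P[cV Vv V0]; rewrite cV V0 andbT /=.
  by apply: (conn_sep cV V0 Vv); rewrite ?p0 ?(ltnW hv) //; lia.
exists (seg (vx 0) (vx 2)); rewrite !inE conn_seg seg_left ?seg_right //.
rewrite seg_end2 !inE /= andbT; apply/negP => h.
have : phi v <= 2 by case/or3P: h => /eqP->; rewrite phi_vx //; lia.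
by rewrite leqNgt hv.
Qed.

Lemma nconn_lt_avoid a b :
  #|[set V in conn_sets a a | b \notin V]| < #|[set V in conn_sets b b | a \notin V]| ->
  nconn a a < nconn b b.
Proof. by rewrite ltnNge -nconn_leq_avoid -ltnNge. Qed.

(** Only [p] itself avoids the hub, whereas two paths avoid [p]: the hub alone and
the hub with its predecessor. *)
Lemma pendant_lt_hub p : p \in pendants -> nconn p p < nconn hub hub.
Proof.
move=> pp; apply: nconn_lt_avoid; apply: (@leq_ltn_trans 1).
  rewrite -(cards1 [set p]); apply/subset_leq_card/subsetP => V.
  rewrite !inE andbb => /andP[/andP[cV Vp] Vh]; apply/eqP/setP => y; rewrite inE.
  apply/idP/eqP => [yV|->//]; apply/eqP/negPn/negP => yp; case/negP: Vh.
  have [|x [px _ xs]] := @seg_next p y; first by rewrite eq_sym.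
  suff <- : x = hub by apply: (subsetP (seg_sub cV Vp yV)).
  rewrite -(labK x); congr vx; move: px; rewrite e_lab !arcE.
  by move: pp; rewrite inE; move: m_ge4; clear => *; lia.
apply: (@leq_trans (2 * 2 ^ #|@set0 T|)); first by rewrite cards0.
apply: (@card_brooms _ (m - 2) 2 set0 set0); rewrite ?sub0set //; first lia.
move=> j S hj; rewrite subset0 => /eqP->; rewrite setU0 in_set in_set.
rewrite conn_broom ?sub0set //; last by move: hj m_ge4; clear => *; lia.
rewrite /broom setU0 !inE hub_lab; move: pp hj m_ge4; rewrite inE.
by clear => *; lia.
Qed.

(** A connected set through [i] that avoids [i + 1] is one of [i + 1] intervals
ending at [i], whereas [2 ^ g] brooms start at [i + 1]. *)
Lemma path_lt_next i : i.+1 < m -> i.+1 < 2 ^ g ->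
  nconn (vx i) (vx i) < nconn (vx i.+1) (vx i.+1).
Proof.
move=> im ig; apply: nconn_lt_avoid; apply: (@leq_ltn_trans i.+1).
  pose f (j : 'I_i.+1) := [set x | j <= lab x <= i].
  apply: (@leq_trans #|f @: [set: 'I_i.+1]|); last first.
    by rewrite (leq_trans (leq_imset_card _ _)) // cardsT card_ord.
  apply/subset_leq_card/subsetP => V; rewrite !inE andbb => /andP[/andP[cV Vi] Vi'].
  case: (@arg_minnP _ (vx i) (mem V) lab Vi) => z zV zmin.
  have zi : lab z < i.+1 by have := zmin _ Vi; rewrite lab_vx //; lia.
  apply/imsetP; exists (Ordinal zi) => //; apply/setP => x; rewrite inE /=.
  apply/idP/andP => [xV|[zx xi]].
    split; first exact: zmin.
    rewrite leqNgt; apply: contra Vi' => ix; apply: (conn_sep cV Vi xV) => //.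
    by rewrite phi_vx ?(ltnW im) // /phi; move: ix im; clear => *; lia.
  have xm : phi x < m by rewrite /phi; move: xi im; clear => *; lia.
  rewrite (phi_eq xm erefl); apply: (conn_sep cV zV Vi) => //.
  by rewrite phi_vx ?(ltnW im) // /phi; move: xi zx im; clear => *; lia.
apply: (leq_trans ig); rewrite -[2 ^ g]mul1n -card_pendants.
apply: (@card_brooms _ i.+1 1 set0 pendants); rewrite ?sub0set ?setD0 //; first lia.
move=> j S hj Sp; have -> : j = i.+1 by move: hj; clear => *; lia.
rewrite in_set in_set set0U conn_broom // !inE !lab_vx ?(ltnW im) //.
rewrite leqnn im /= ltnn /=; apply/negP => /(subsetP Sp).
by rewrite inE lab_vx ?(ltnW im) //; move: im; clear => *; lia.
Qed.

Lemma core_path_star v : v \in subtree_core e ->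
  lab v < m /\ (lab v = m.-1 \/ 2 ^ g <= (lab v).+1).
Proof.
move=> /coreP hv; have vm : lab v < m.
  rewrite ltnNge; apply/negP => mv; have := hv hub.
  by rewrite leqNgt pendant_lt_hub ?inE.
split => //; case: (leqP (2 ^ g) (lab v).+1) => hg; first by right.
left; apply/eqP/negPn/negP => hm; have := hv (vx (lab v).+1).
by rewrite -{3 4}(labK v) leqNgt path_lt_next //; move: hm vm; clear => *; lia.
Qed.

Lemma path_star_set_dist_geq :
  (if m + g == 7 then 1 else m - 3) <= set_dist e (subtree_core e) (core_center e).
Proof.
have mT : m <= #|T|.
  apply: (@leq_trans #|seg hub (vx 0)|); last exact: max_card.
  have := phi_dist hub (vx 0); rewrite dist_seg !phi_vx; lia.
apply: set_dist_geq => [|s c /core_path_star[sm hs] /center_path_star->].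
  by move: m_ge4 mT; case: ifP => _; clear => *; lia.
have := phi_dist s (vx 2); rewrite phi_vx; last lia.
have -> : phi s = lab s by rewrite /phi; lia.
have g4 : 2 ^ g = (2 ^ (g - 1)).*2 by rewrite -mul2n -expnS; congr (_ ^ _); lia.
have g2 : 2 <= 2 ^ (g - 1) by rewrite -{1}(expn1 2) leq_exp2l //; lia.
(* m = 5 and g = 2 is the case of seven vertices. *)
have g3 : m = 5 -> g != 2 -> 4 <= 2 ^ (g - 1).
  by move=> _ g2'; rewrite -[4]/(2 ^ 2) leq_exp2l //; lia.
move: hs; rewrite g4; move: m_le g2 g3; move: (2 ^ (g - 1)) => X.
case: ifP => [/eqP n7|/eqP n7]; move: (dist _ _ _) sm m_ge4 g_ge2 n7 => D; clear.
  by move=> *; lia.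
by move=> sm m4 g2 n7 mX X2 g3 hs; case: (eqVneq m 5); case: (eqVneq g 2); lia.
Qed.

End PathStar.

End Tree.

Theorem theorem5p10 (n : nat) (T : finType) (e : rel T)
    (n_ge6 : 6 <= n) (tree_e : is_tree e) (card_T : #|T| = n)
    (g0 : nat) (g0_ge2 : 2 <= g0)
    (g0P : n - 3 <= 2 ^ (g0 - 1) + g0)
    (g0_min : forall g : nat, 0 < g -> n - 3 <= 2 ^ (g - 1) + g -> g0 <= g) :
  let bound := if n == 7 then 1 else n - g0 - 3 in
  set_dist e (subtree_core e) (core_center e) <= bound /\
  (isomorphic e (@path_star n g0) ->
   set_dist e (subtree_core e) (core_center e) = bound).
Proof.
have ub : set_dist e (subtree_core e) (core_center e) <=
    if n == 7 then 1 else n - g0 - 3.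
  by rewrite -card_T; apply: core_center_set_dist_leq; rewrite ?card_T.
split => // -[f [f' fK f'K] f_e]; apply/eqP; rewrite eqn_leq ub /=.
(* The spine has at least four vertices: n - 4 satisfies the inequality. *)
have g0n : g0 <= n - 4.
  apply: g0_min; first lia.
  have : 0 < 2 ^ (n - 4 - 1) by rewrite expn_gt0.
  by move: n_ge6; clear => *; lia.
have [x0 _] : exists x0 : T, x0 \in T by apply/card_gt0P; rewrite card_T; lia.
have nE : (n - g0) + g0 = n by lia.
pose vx i := f' (insubd (f x0) i).
have := @path_star_set_dist_geq T e tree_e (n - g0) g0 (fun x => val (f x)) vx.
rewrite nE; apply.
- by move=> x; apply: ltn_ord.
- by move=> x; rewrite /vx valKd fK.
- by move=> i i_n; rewrite /vx f'K val_insubd i_n.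
- by move=> x y; rewrite -f_e.
- lia.
- by [].
- by move: g0P; clear => *; lia.
Qed.
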